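(* Let $b\in\mathbb{S}\setminus\mathbb{R}$ have real part $b_0=0$, let $\lambda,\mu\in\mathbb{R}$, and consider $P=t^2+bt+\lambda+\mu b\in\mathbb{S}[t]$. (1) If $bb^\ast>0$, then $P$ admits a factorization. (2) If $bb^\ast=0$, then $P$ admits a factorization if and only if $\lambda+\mu^2=0$ or $\lambda<0$. (3) If $bb^\ast<0$, then $P$ admits a factorization if and only if either $\lambda+\mu^2=0$, or both $bb^\ast+4\lambda\le 0$ and $bb^\ast+4\lambda\le 4\mu\sqrt{-bb^\ast}\le -(bb^\ast+4\lambda)$ hold.
   Context: The algebra $\mathbb{S}$ of split quaternions is the four-dimensional real associative unital algebra with basis $1,\mathbf{i},\mathbf{j},\mathbf{k}$ and multiplication determined by $\mathbf{i}^2=-1$, $\mathbf{j}^2=\mathbf{k}^2=1$, $\mathbf{i}\mathbf{j}\mathbf{k}=1$ (so $\mathbf{i},\mathbf{j},\mathbf{k}$ pairwise anti-commute and $\mathbf{i}\mathbf{j}=\mathbf{k}$). $\mathbb{R}$ is identified with $\mathbb{R}\cdot 1\subset\mathbb{S}$. For $h=h_0+h_1\mathbf{i}+h_2\mathbf{j}+h_3\mathbf{k}$ (with $h_\ell\in\mathbb{R}$), the real part is $h_0$, the conjugate is $h^\ast=h_0-h_1\mathbf{i}-h_2\mathbf{j}-h_3\mathbf{k}$, and the norm is $hh^\ast=h^\ast h=h_0^2+h_1^2-h_2^2-h_3^2\in\mathbb{R}$. $\mathbb{S}[t]$ is the ring of polynomials in one indeterminate $t$ over $\mathbb{S}$, where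 $t$ commutes with all coefficients. A monic quadratic polynomial $P\in\mathbb{S}[t]$ admits a factorization if there exist $h_1,h_2\in\mathbb{S}$ with $P=(t-h_1)(t-h_2)$. *)

(* Defs.v *)
From HB Require Import structures.
From mathcomp Require Import all_boot all_order all_algebra.
From mathcomp Require Import reals.
From mathcomp Require Import ring.

Set Implicit Arguments.
Unset Strict Implicit.
Unset Printing Implicit Defensive.

Import Order.TTheory GRing.Theory Num.Theory.

Local Open Scope ring_scope.

(* [SplitQuat h0 h1 h2 h3] is h0 + h1 i + h2 j + h3 k; see [sq_basisE]. *)
Record split_quat (R : Type) := SplitQuat { sq0 : R; sq1 : R; sq2 : R; sq3 : R }.

Section SplitQuatCombinatorial.
Variable R : Type.

Definition sq_to_tuple (h : split_quat R) : R * R * R * R :=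
  (sq0 h, sq1 h, sq2 h, sq3 h).

Definition sq_of_tuple (p : R * R * R * R) : split_quat R :=
  let: (a, b, c, d) := p in SplitQuat a b c d.

Lemma sq_to_tupleK : cancel sq_to_tuple sq_of_tuple.
Proof. by case. Qed.

End SplitQuatCombinatorial.

HB.instance Definition _ (R : eqType) :=
  Equality.copy (split_quat R) (can_type (@sq_to_tupleK R)).
HB.instance Definition _ (R : choiceType) :=
  Choice.copy (split_quat R) (can_type (@sq_to_tupleK R)).

Section SplitQuatAlgebra.
Variable R : comNzRingType.
Implicit Types (g h : split_quat R) (a : R).

Definition sq_zero : split_quat R := SplitQuat 0 0 0 0.

Definition sq_opp h := SplitQuat (- sq0 h) (- sq1 h) (- sq2 h) (- sq3 h).

Definition sq_add g h :=
  SplitQuat (sq0 g + sq0 h) (sq1 g + sq1 h) (sq2 g + sq2 h) (sq3 g + sq3 h).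

Definition sq_one : split_quat R := SplitQuat 1 0 0 0.

(* From i^2 = -1, j^2 = k^2 = 1, ij = -ji = k, jk = -kj = -i, ki = -ik = j. *)
Definition sq_mul g h :=
  SplitQuat
    (sq0 g * sq0 h - sq1 g * sq1 h + sq2 g * sq2 h + sq3 g * sq3 h)
    (sq0 g * sq1 h + sq1 g * sq0 h - sq2 g * sq3 h + sq3 g * sq2 h)
    (sq0 g * sq2 h - sq1 g * sq3 h + sq2 g * sq0 h + sq3 g * sq1 h)
    (sq0 g * sq3 h + sq1 g * sq2 h - sq2 g * sq1 h + sq3 g * sq0 h).

Definition sq_scale a h :=
  SplitQuat (a * sq0 h) (a * sq1 h) (a * sq2 h) (a * sq3 h).

Lemma sq_addA : associative sq_add.
Proof. by move=> [? ? ? ?] [? ? ? ?] [? ? ? ?]; rewrite /sq_add /= !addrA. Qed.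

Lemma sq_addC : commutative sq_add.
Proof.
move=> [a b c d] [a' b' c' d']; rewrite /sq_add /=.
by rewrite (addrC a) (addrC b) (addrC c) (addrC d).
Qed.

Lemma sq_add0 : left_id sq_zero sq_add.
Proof. by move=> [? ? ? ?]; rewrite /sq_add /= !add0r. Qed.

Lemma sq_addN : left_inverse sq_zero sq_opp sq_add.
Proof. by move=> [? ? ? ?]; rewrite /sq_add /= !addNr. Qed.

HB.instance Definition _ :=
  GRing.isZmodule.Build (split_quat R) sq_addA sq_addC sq_add0 sq_addN.

Lemma sq_mulA : associative sq_mul.
Proof. by move=> [? ? ? ?] [? ? ? ?] [? ? ? ?]; congr SplitQuat => /=; ring. Qed.

Lemma sq_mul1l : left_id sq_one sq_mul.
Proof. by move=> [? ? ? ?]; congr SplitQuat => /=; ring. Qed.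

Lemma sq_mul1r : right_id sq_one sq_mul.
Proof. by move=> [? ? ? ?]; congr SplitQuat => /=; ring. Qed.

Lemma sq_mulDl : left_distributive sq_mul +%R.
Proof. by move=> [? ? ? ?] [? ? ? ?] [? ? ? ?]; congr SplitQuat => /=; ring. Qed.

Lemma sq_mulDr : right_distributive sq_mul +%R.
Proof. by move=> [? ? ? ?] [? ? ? ?] [? ? ? ?]; congr SplitQuat => /=; ring. Qed.

Lemma sq_one_neq0 : sq_one != 0.
Proof. by apply/eqP => -[] /eqP; rewrite oner_eq0. Qed.

HB.instance Definition _ :=
  GRing.Zmodule_isNzRing.Build (split_quat R)
    sq_mulA sq_mul1l sq_mul1r sq_mulDl sq_mulDr sq_one_neq0.

Lemma sq_scaleA a a' h : sq_scale a (sq_scale a' h) = sq_scale (a * a') h.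
Proof. by congr SplitQuat => /=; ring. Qed.

Lemma sq_scale1 : left_id 1 sq_scale.
Proof. by move=> [? ? ? ?]; congr SplitQuat => /=; ring. Qed.

Lemma sq_scaleDr : right_distributive sq_scale +%R.
Proof. by move=> ? [? ? ? ?] [? ? ? ?]; congr SplitQuat => /=; ring. Qed.

Lemma sq_scaleDl h : {morph sq_scale^~ h : a a' / a + a'}.
Proof. by move=> ? ?; congr SplitQuat => /=; ring. Qed.

HB.instance Definition _ :=
  GRing.Zmodule_isLmodule.Build R (split_quat R)
    sq_scaleA sq_scale1 sq_scaleDr sq_scaleDl.

Lemma sq_scaleAl a g h : a *: (g * h) = (a *: g) * h.
Proof. by congr SplitQuat => /=; ring. Qed.

HB.instance Definition _ :=
  GRing.Lmodule_isLalgebra.Build R (split_quat R) sq_scaleAl.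

Lemma sq_scaleAr a g h : a *: (g * h) = g * (a *: h).
Proof. by congr SplitQuat => /=; ring. Qed.

HB.instance Definition _ :=
  GRing.Lalgebra_isAlgebra.Build R (split_quat R) sq_scaleAr.

Definition sq_i : split_quat R := SplitQuat 0 1 0 0.
Definition sq_j : split_quat R := SplitQuat 0 0 1 0.
Definition sq_k : split_quat R := SplitQuat 0 0 0 1.

Lemma sq_basisE h :
  h = (sq0 h)%:A + sq1 h *: sq_i + sq2 h *: sq_j + sq3 h *: sq_k.
Proof. by case: h => ? ? ? ?; congr SplitQuat => /=; ring. Qed.

Lemma sq_ii : sq_i * sq_i = -1.
Proof. by congr SplitQuat => /=; ring. Qed.

Lemma sq_jj : sq_j * sq_j = 1.
Proof. by congr SplitQuat => /=; ring. Qed.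

Lemma sq_kk : sq_k * sq_k = 1.
Proof. by congr SplitQuat => /=; ring. Qed.

Lemma sq_ijk : sq_i * sq_j * sq_k = 1.
Proof. by congr SplitQuat => /=; ring. Qed.

(* The scalars are identified with their image under [a |-> a%:A]. *)
Definition sq_scalar h := exists a : R, h = a%:A.

Definition sq_re h : R := sq0 h.

Definition sq_conj h := SplitQuat (sq0 h) (- sq1 h) (- sq2 h) (- sq3 h).

(* The product h h^* is a scalar, see [sq_mul_conj]; its value in R is its
   real part. *)
Definition sq_norm h : R := sq_re (h * sq_conj h).

Lemma sq_normE h :
  sq_norm h = sq0 h ^+ 2 + sq1 h ^+ 2 - sq2 h ^+ 2 - sq3 h ^+ 2.
Proof. by rewrite /sq_norm /sq_re /=; ring. Qed.

Lemma sq_mul_conj h : h * sq_conj h = (sq_norm h)%:A.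
Proof. by congr SplitQuat => /=; rewrite ?sq_normE; ring. Qed.

Lemma sq_conj_mul h : sq_conj h * h = (sq_norm h)%:A.
Proof. by congr SplitQuat => /=; rewrite ?sq_normE; ring. Qed.

(* Coefficients commute with 'X in {poly _} ([commr_polyX]), also over a
   noncommutative ring. *)
Definition admits_factorization (P : {poly split_quat R}) :=
  exists h1 h2 : split_quat R, P = ('X - h1%:P) * ('X - h2%:P).

End SplitQuatAlgebra.

(* Main.v *)
Require Import Defs.
From HB Require Import structures.
From mathcomp Require Import all_boot all_order all_algebra.
From mathcomp Require Import reals.
From mathcomp Require Import ring lra.

Set Implicit Arguments.
Unset Strict Implicit.
Unset Printing Implicit Defensive.

Import Order.TTheory GRing.Theory Num.Theory.

Local Open Scope ring_scope.

(** A factorization of P is the same as a root h of h^2 + b h + lambda + mu b.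
    Completing the square, h = x - b/2 + y b is a root as soon as
    (x + y b)^2 = - N/4 - lambda - mu b, where N = b b^*; this is solved by
    taking a square root in R[b], which is the complex, dual or split-complex
    numbers according to the sign of N. Conversely, let x be the real part of a
    root, m the norm of its vector part and d the inner product of the latter
    with b. Pairing the vector part of the equation with b and with the root
    expresses d, m and then lambda through x when x != 0, and
    N/4 + lambda = N mu^2 / (4 x^2) - x^2; the inequalities for N < 0 are
    then an instance of AM-GM. *)

(** Comparing linear coefficients forces the left factor to have [g = - b - h]; the constant term
    then says that [h] is a root. *)
Lemma admits_factorizationP (R : comNzRingType) (b c : split_quat R) :
  admits_factorization ('X^2 + b%:P * 'X + c%:P) <->
  exists h, h * h + b * h + c = 0.
Proof.
have expand (g h : split_quat R) : ('X - g%:P) * ('X - h%:P) =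
    'X^2 + (- (g + h))%:P * 'X + (g * h)%:P.
  rewrite mulrBl !mulrBr -(commr_polyX h%:P) -expr2 -polyCM polyCN polyCD.
  by rewrite mulNr mulrDl !opprD opprK !addrA (addrAC 'X^2).
split=> [[g [h]]|[h root_h]].
  rewrite expand => eqP.
  have coefs (u v : split_quat R) i :
      ('X^2 + u%:P * 'X + v%:P)`_i =
        (i == 2)%:R + (if i == 0 then 0 else (if i.-1 == 0 then u else 0)) +
        (if i == 0 then v else 0) by rewrite !coefD coefXn coefMX !coefC.
  have := congr1 (fun p : {poly _} => p`_0) eqP.
  have := congr1 (fun p : {poly _} => p`_1) eqP.
  rewrite /= !coefs /= !add0r !addr0 => -> ->; exists h.
  by rewrite mulNr mulrDl opprD [h * h + _]addrC subrK addNr.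
exists (- b - h), h; rewrite expand subrK opprK; congr (_ + _%:P).
rewrite mulrBl mulNr -opprD.
apply/eqP; rewrite -addr_eq0 addrC (addrC (b * h)).
by rewrite root_h.
Qed.

(** As b^2 = - N, the two equations are the scalar part and the [b] part of (x + y b)^2 = - N/4 -
    lambda - mu b. *)
Lemma quadratic_factorization (R : realFieldType) (b : split_quat R)
    (lambda mu x y : R) :
  sq_re b = 0 ->
  x ^+ 2 - sq_norm b * y ^+ 2 = - sq_norm b / 4 - lambda ->
  2 * x * y = - mu ->
  admits_factorization ('X^2 + b%:P * 'X + (lambda%:A + mu *: b)%:P).
Proof.
rewrite sq_normE; case: b => b0 b1 b2 b3; rewrite /sq_re /= => -> Ere Evec.
apply/admits_factorizationP.
have -> : mu = - (2 * x * y) by rewrite Evec opprK.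
exists (SplitQuat x ((y - 1 / 2) * b1) ((y - 1 / 2) * b2) ((y - 1 / 2) * b3)).
have -> : lambda = - (0 ^+ 2 + b1 ^+ 2 - b2 ^+ 2 - b3 ^+ 2) / 4 -
    (x ^+ 2 - (0 ^+ 2 + b1 ^+ 2 - b2 ^+ 2 - b3 ^+ 2) * y ^+ 2) by rewrite Ere; ring.
by congr SplitQuat => /=; field.
Qed.

(** The scalar [- mu] is a root, and P = (t + mu)(t - mu + b). *)
Lemma linear_factorization (R : comNzRingType) (b : split_quat R) (lambda mu : R) :
  lambda + mu ^+ 2 = 0 ->
  admits_factorization ('X^2 + b%:P * 'X + (lambda%:A + mu *: b)%:P).
Proof.
move=> /eqP; rewrite addr_eq0 => /eqP ->; apply/admits_factorizationP.
exists (mu%:A - b); case: b => b0 b1 b2 b3.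
by congr SplitQuat => /=; ring.
Qed.

(* Here d is the inner product of b with the vector part of h, and m the norm
   of that vector part. *)
Lemma root_relations (R : realFieldType) (b h : split_quat R) (lambda mu : R) :
  sq_re b = 0 -> h * h + b * h + (lambda%:A + mu *: b) = 0 ->
  exists d m : R,
    [/\ sq_re h ^+ 2 + lambda = m + d,
        2 * sq_re h * d = - (sq_re h + mu) * sq_norm b,
        2 * sq_re h * m = - (sq_re h + mu) * d,
        sq_re h = 0 -> d ^+ 2 = sq_norm b * (m - mu ^+ 2)
      & sq_re h = 0 -> d = 0 -> (m + mu ^+ 2) *: b = 0].
Proof.
rewrite sq_normE; case: b => b0 b1 b2 b3; case: h => x p q r.
rewrite /sq_re /= => -> [].
rewrite /= ?mulr0 ?mulr1 => E0 E1 E2 E3.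
exists (b1 * p - b2 * q - b3 * r), (p ^+ 2 - q ^+ 2 - r ^+ 2).
split.
- by lra.
- by have := (congr1 ( *%R b1) E1, congr1 ( *%R b2) E2, congr1 ( *%R b3) E3);
    case=> -[]; lra.
- by have := (congr1 ( *%R p) E1, congr1 ( *%R q) E2, congr1 ( *%R r) E3);
    case=> -[]; lra.
(* With w the vector part of [b * h], the equations read w + mu b = 0. Pairing with w - mu b gives
   norm(w) = mu^2 N, while multiplicativity of the norm gives norm(w) = N m - d^2. *)
- move=> x0; move: E0 E1 E2 E3; rewrite x0 => E0 E1 E2 E3.
  have := (congr1 ( *%R (b3 * q - b2 * r - mu * b1)) E1,
           congr1 ( *%R (b3 * p - b1 * r - mu * b2)) E2,
           congr1 ( *%R (b1 * q - b2 * p - mu * b3)) E3).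
  by case=> -[]; lra.
(* Now b h = - mu b, hence b h^2 = mu^2 b, whereas h^2 = - m. *)
- move=> x0 d0; move: E0 E1 E2 E3; rewrite x0 => E0 E1 E2 E3.
  congr SplitQuat => /=; first by rewrite mulr0.
  + have := (congr1 ( *%R mu) E1, congr1 ( *%R r) E2, congr1 ( *%R q) E3,
             congr1 ( *%R p) d0).
    by case=> -[] -[]; lra.
  + have := (congr1 ( *%R r) E1, congr1 ( *%R mu) E2, congr1 ( *%R p) E3,
             congr1 ( *%R q) d0).
    by case=> -[] -[]; lra.
  + have := (congr1 ( *%R q) E1, congr1 ( *%R p) E2, congr1 ( *%R mu) E3,
             congr1 ( *%R r) d0).
    by case=> -[] -[]; lra.
Qed.

(** With s = sqrt(N), this is the complex equation (x + i s y)^2 = A - i s mu, and [r] below is the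
    modulus of its right-hand side. *)
Lemma exists_sqrt_definite (R : rcfType) (N A mu : R) :
  0 < N -> exists x y : R, x ^+ 2 - N * y ^+ 2 = A /\ 2 * x * y = - mu.
Proof.
move=> N_gt0; have [->|mu_neq0] := eqVneq mu 0.
  have [A_ge0|A_lt0] := leP 0 A.
    by exists (Num.sqrt A), 0; rewrite sqr_sqrtr //; split; ring.
  exists 0, (Num.sqrt (- A / N)); rewrite sqr_sqrtr; last first.
    by rewrite divr_ge0 ?oppr_ge0 ?ltW.
  by split; [field; rewrite gt_eqF | ring].
have mu2_gt0 : 0 < N * mu ^+ 2 by rewrite mulr_gt0 // exprn_even_gt0.
pose r := Num.sqrt (A ^+ 2 + N * mu ^+ 2).
have r2 : r ^+ 2 = A ^+ 2 + N * mu ^+ 2.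
  by rewrite sqr_sqrtr // addr_ge0 ?sqr_ge0 // ltW.
(* Strict because [mu] is nonzero; this allows the division by [x] in [y]. *)
have rA_gt0 : 0 < r + A.
  have : `|A| < r by rewrite -sqrtr_sqr ltr_sqrt ?ltrDl // ltr_wpDl ?sqr_ge0.
  by rewrite ltr_norml => /andP[]; lra.
pose x := Num.sqrt ((r + A) / 2).
have x2 : x ^+ 2 = (r + A) / 2 by rewrite sqr_sqrtr // divr_ge0 ?ltW.
have x_neq0 : x != 0 by rewrite gt_eqF // sqrtr_gt0 divr_gt0.
exists x, (- mu / (2 * x)); split; last by field.
rewrite exprMn sqrrN exprVn exprMn x2.
have -> : N * (mu ^+ 2 / (2 ^+ 2 * ((r + A) / 2))) =
    (r ^+ 2 - A ^+ 2) / (2 * (r + A)) by rewrite r2; field; rewrite gt_eqF.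
by field; rewrite gt_eqF.
Qed.

(** With N = - B^2, the coordinates u = x + B y and v = x - B y decouple the system into u^2 = A -
    mu B and v^2 = A + mu B; the bounds make both right-hand sides nonnegative. *)
Lemma exists_sqrt_indefinite (R : rcfType) (N A mu : R) :
  N < 0 -> - A <= mu * Num.sqrt (- N) <= A ->
  exists x y : R, x ^+ 2 - N * y ^+ 2 = A /\ 2 * x * y = - mu.
Proof.
rewrite -oppr_gt0 => N_gt0 /andP[leA geA].
have := sqr_sqrtr (ltW N_gt0); move: N_gt0 leA geA; rewrite -sqrtr_gt0.
set B := Num.sqrt _ => B_gt0 leA geA B2.
pose u := Num.sqrt (A - mu * B); pose v := Num.sqrt (A + mu * B).
have u2 : u ^+ 2 = A - mu * B by rewrite sqr_sqrtr //; lra.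
have v2 : v ^+ 2 = A + mu * B by rewrite sqr_sqrtr //; lra.
have B_neq0 : B != 0 by rewrite gt_eqF.
exists ((u + v) / 2), ((u - v) / (2 * B)); split.
  transitivity ((u ^+ 2 + v ^+ 2) / 2); last by rewrite u2 v2; field.
  by rewrite -[N]opprK -B2; field.
transitivity ((u ^+ 2 - v ^+ 2) / (2 * B)); first by field.
by rewrite u2 v2; field.
Qed.

(** A root with zero real part yields the first alternative; otherwise [d] and [m] vanish and lambda
    = - x^2. *)
Lemma root_norm0 (R : realFieldType) (b h : split_quat R) (lambda mu : R) :
  b != 0 -> sq_re b = 0 -> sq_norm b = 0 ->
  h * h + b * h + (lambda%:A + mu *: b) = 0 ->
  lambda + mu ^+ 2 = 0 \/ lambda < 0.
Proof.
move=> b_neq0 b_re0 N0 /(root_relations b_re0) [d [m []]]; rewrite N0.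
set x := sq_re h; have [->|x_neq0] := eqVneq x 0.
  move=> E0 _ _ /(_ erefl) d2 /(_ erefl) b_m; left.
  have d0 : d = 0 by apply/eqP; rewrite -sqrf_eq0 d2 mul0r.
  have /eqP := b_m d0; rewrite scaler_eq0 (negPf b_neq0) orbF => /eqP.
  by move: E0; rewrite d0; lra.
move=> E0 E1 E2 _ _; right.
have x2_neq0 : 2 * x != 0 by rewrite mulf_neq0 ?pnatr_eq0.
have d0 : d = 0.
  by apply: (mulfI x2_neq0); rewrite E1; ring.
have m0 : m = 0.
  by apply: (mulfI x2_neq0); rewrite E2 d0; ring.
have : 0 < x ^+ 2 by rewrite exprn_even_gt0.
by move: E0; rewrite d0 m0; lra.
Qed.

Lemma root_norm_lt0 (R : rcfType) (b h : split_quat R) (lambda mu : R) :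
  sq_re b = 0 -> sq_norm b < 0 ->
  h * h + b * h + (lambda%:A + mu *: b) = 0 ->
  sq_norm b + 4 * lambda <= 4 * mu * Num.sqrt (- sq_norm b)
    <= - (sq_norm b + 4 * lambda).
Proof.
move=> b_re0 N_lt0 /(root_relations b_re0) [d [m []]].
have N_gt0 : 0 < - sq_norm b by rewrite oppr_gt0.
have := sqr_sqrtr (ltW N_gt0); set B := Num.sqrt _; set N := sq_norm b.
set x := sq_re h => B2; have NE : N = - B ^+ 2 by rewrite B2 opprK.
have N_neq0 : N != 0 by rewrite lt_eqF.
have [->|x_neq0] := eqVneq x 0.
  move=> E0 E1 _ /(_ erefl) d2 _.
  have mu0 : mu = 0 by apply: (mulIf N_neq0); move: E1; lra.
  have le0 : N + 4 * lambda <= 0.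
    suff : 0 <= (N + 4 * lambda) * N by rewrite nmulr_lge0.
    have -> : (N + 4 * lambda) * N = (N + 2 * d) ^+ 2.
      by move: E0 d2 (congr1 ( *%R N) E0); rewrite mu0; lra.
    exact: sqr_ge0.
  by rewrite mu0; lra.
move=> E0 E1 E2 _ _.
have dE : d = - (x + mu) * N / (2 * x) by rewrite -E1; field.
have mE : m = - (x + mu) * d / (2 * x) by rewrite -E2; field.
(* This choice makes the outer terms z^2 + 4 x^2 up to sign and the middle one 4 x z. *)
pose z := mu * B / x.
have -> : 4 * mu * B = 4 * x * z by rewrite /z; field.
have -> : N + 4 * lambda = - (z ^+ 2 + 4 * x ^+ 2).
  have -> : lambda = m + d - x ^+ 2 by rewrite -E0; ring.
  by rewrite mE dE NE /z; field.
(* AM-GM *)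
have := sqr_ge0 (z + 2 * x); have := sqr_ge0 (z - 2 * x); lra.
Qed.

Theorem theorem3p6 (R : realType) (b : split_quat R) (lambda mu : R)
    (b_nonreal : ~ sq_scalar b) (b_re0 : sq_re b = 0) :
  let P : {poly split_quat R} :=
    'X^2 + b%:P * 'X + (lambda%:A + mu *: b)%:P in
  [/\ 0 < sq_norm b -> admits_factorization P,
      sq_norm b = 0 ->
        (admits_factorization P <-> lambda + mu ^+ 2 = 0 \/ lambda < 0)
    & sq_norm b < 0 ->
        (admits_factorization P <->
           lambda + mu ^+ 2 = 0 \/
           (sq_norm b + 4 * lambda <= 0 /\
            sq_norm b + 4 * lambda <= 4 * mu * Num.sqrt (- sq_norm b)
              <= - (sq_norm b + 4 * lambda)))].
Proof.
move=> P; have root_of : admits_factorization P ->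
    exists h, h * h + b * h + (lambda%:A + mu *: b) = 0.
  by move/admits_factorizationP.
split=> [N_gt0|N0|N_lt0].
- have [x [y [Ere Evec]]] :=
    exists_sqrt_definite (- sq_norm b / 4 - lambda) mu N_gt0.
  exact: quadratic_factorization Ere Evec.
- split=> [/root_of[h]|[|lambda_lt0]].
  + apply: root_norm0 => //; apply/eqP => b0; apply: b_nonreal.
    by exists 0; rewrite scale0r.
  + exact: linear_factorization.
  (* For N = 0 the system is triangular: x^2 = - lambda, then 2 x y = - mu gives [y]. *)
  + have x_gt0 : 0 < Num.sqrt (- lambda) by rewrite sqrtr_gt0 oppr_gt0.
    apply: (@quadratic_factorization _ _ _ _ (Num.sqrt (- lambda))
             (- mu / (2 * Num.sqrt (- lambda)))) => //.
      by rewrite N0 sqr_sqrtr ?oppr_ge0 ?ltW //; ring.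
    by field; rewrite gt_eqF.
- split=> [/root_of[h] /(root_norm_lt0 b_re0 N_lt0) bounds|].
    (* The outer terms of the bounds alone give N + 4 lambda <= 0. *)
    by right; split=> //; lra.
  case=> [|[_ bounds]]; first exact: linear_factorization.
  have [|x [y [Ere Evec]]] :=
    @exists_sqrt_indefinite _ _ (- sq_norm b / 4 - lambda) mu N_lt0.
    by lra.
  exact: quadratic_factorization Ere Evec.
Qed.
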